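(* Let $R$ be a principal ideal domain, let $n\in\mathbb{N}$, and let $A\in \mathrm{M}_n(R)$ be a matrix with trace zero. Then $A=[X,Y]$ for some $X,Y\in \mathrm{M}_n(R)$.
   Context: $\mathbb{N}=\{1,2,\dots\}$. $\mathrm{M}_n(R)$ is the ring of $n\times n$ matrices over $R$, and $[X,Y]=XY-YX$ is the commutator of $X$ and $Y$. All rings are commutative with identity. *)

(* Defs.v *)
From HB Require Import structures.
From mathcomp Require Import all_boot all_order all_algebra.

Set Implicit Arguments.
Unset Strict Implicit.
Unset Printing Implicit Defensive.

Import GRing.Theory.
Local Open Scope ring_scope.

(* Ideals are Prop-valued subsets: the library's idealr_closed covers only
   decidable (boolean) and proper ideals, whereas all ideals are meant here. *)
Definition is_ideal (R : comPzRingType) (I : R -> Prop) : Prop :=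
  [/\ I 0,
      forall x y, I x -> I y -> I (x + y)
    & forall a x, I x -> I (a * x)].

Definition principal (R : comPzRingType) (I : R -> Prop) : Prop :=
  exists d, forall x, I x <-> exists a, x = a * d.

Definition is_PID (R : idomainType) : Prop :=
  forall I : R -> Prop, is_ideal I -> principal I.

Definition mx_comm (R : pzRingType) (n : nat) (X Y : 'M[R]_n) : 'M[R]_n :=
  X *m Y - Y *m X.

(* Main.v *)
Require Import Defs.
From mathcomp Require Import all_boot all_order all_algebra.
From mathcomp Require Import ring zify.

(** A commutator [A] of [X] with another matrix satisfies
    [\tr (X ^+ r *m A) = 0] for all [r].
    The proof chooses, for a given trace zero [A], a matrix [X] which satisfies
    these conditions and for which they are also sufficient.

    After a change of basis, [A] is lower Hessenberg: its only nonzero entries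
    above the diagonal are the [u_i] in positions (i, i + 1).  Take [X] lower
    triangular with diagonal 0, c, 0, c, ..., with entries [s_i] just below it,
    and with a second subdiagonal adjusted so that [W = X ^+ 2 - c X] has ones
    in all positions (i + 2, i) and zeros above them; this is possible as soon
    as [s_i s_(i+1)] is congruent to 1 modulo [c].

    The trace conditions hold: each positive power of [X] is a multiple of [X]
    plus a matrix [W Q] with [Q] lower triangular, and [W Q] lives too far below
    the diagonal to be seen by the trace against a Hessenberg matrix.  Only
    [\tr A = 0] and [\tr (X A) = 0] remain, and the second one is the linear
    relation [c T + sum of the s_i u_i = 0], where [T] is the sum of every
    other diagonal entry of [A].  [superdiag_relation] solves it under the
    congruence constraint on the [s_i]; this is the arithmetic part.

    The trace conditions suffice: for a vector [v], let [K] have the columns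
    v, X v, W v, W X v, W ^+ 2 v, ...  Then [X K = K H], where [H] is lower
    bidiagonal with diagonal 0, c, 0, c, ... and ones below it.  For such an [H]
    the criterion is elementary ([bidiag_comm]), and conjugating by [K] and its
    adjugate gives that [(det K) ^+ 2 A] is a commutator with [X]
    ([intertwined_comm]).  The matrix [K] is triangular; one choice of [v] makes
    its determinant a power of [s_0], and another makes it a power of [c].
    These are coprime, so a linear combination of the two solutions writes
    [A] itself as a commutator with [X]. *)

Set Implicit Arguments.
Unset Strict Implicit.
Unset Printing Implicit Defensive.

Import GRing.Theory.
Local Open Scope ring_scope.

(** * Comaximal elements and gcds *)

Definition comax (R : comPzRingType) (a b : R) : Prop :=
  exists p q, p * a + q * b = 1.

Lemma comaxC (R : comPzRingType) (a b : R) : comax a b -> comax b a.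
Proof. by case=> p [q e]; exists q, p; rewrite addrC. Qed.

Lemma comaxMr (R : comPzRingType) (a b1 b2 : R) :
  comax a b1 -> comax a b2 -> comax a (b1 * b2).
Proof.
move=> [p1 [q1 e1]] [p2 [q2 e2]].
exists (p1 * p2 * a + p1 * q2 * b2 + q1 * b1 * p2), (q1 * q2).
by rewrite -[RHS]mulr1 -{1}e1 -e2; ring.
Qed.

Lemma comax1 (R : comPzRingType) (a : R) : comax a 1.
Proof. by exists 0, 1; rewrite mul0r add0r mulr1. Qed.

Lemma comaxXr (R : comPzRingType) (a b : R) k : comax a b -> comax a (b ^+ k).
Proof.
move=> ab; elim: k => [|k IHk]; first exact: comax1.
by rewrite exprS; apply: comaxMr.
Qed.

Lemma comax_dvdr (R : comPzRingType) (a b x : R) :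
  comax a (b * x) -> comax a b.
Proof. by case=> p [q e]; exists p, (q * x); rewrite -e; ring. Qed.

Lemma comax_addMl (R : comPzRingType) (a b x : R) :
  comax a b -> comax (a + x * b) b.
Proof. by case=> p [q e]; exists p, (q - p * x); rewrite -e; ring. Qed.

Section PID.
Variables (R : idomainType) (R_pid : is_PID R).

Lemma bezout (m : nat) (u : 'I_m -> R) :
  exists (g : R) (r u' : 'I_m -> R),
    g = \sum_i r i * u i /\ forall i, u i = u' i * g.
Proof.
pose I (x : R) := exists r : 'I_m -> R, x = \sum_i r i * u i.
have /R_pid[g gP] : is_ideal I.
  split.
  - by exists (fun=> 0); rewrite big1 // => i _; rewrite mul0r.
  - move=> _ _ [r1 ->] [r2 ->]; exists (fun i => r1 i + r2 i).
    by rewrite -big_split /=; apply: eq_bigr => i _; rewrite mulrDl.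
  - move=> a _ [r ->]; exists (fun i => a * r i).
    by rewrite mulr_sumr; apply: eq_bigr => i _; rewrite mulrA.
have /gP[r rE] : exists a, g = a * g by exists 1; rewrite mul1r.
have /fin_all_exists[u' u'E] i : exists a, u i = a * g.
  apply/gP; exists (fun k => (k == i)%:R).
  by rewrite (bigD1 i) //= eqxx mul1r big1 ?addr0 // => k /negPf->; rewrite mul0r.
by exists g, r, u'.
Qed.

Lemma bezout2 (a b : R) : exists g p q a' b' : R,
  [/\ g = p * a + q * b, a = a' * g & b = b' * g].
Proof.
have [g [r [u' [gE uE]]]] := bezout (fun i : 'I_2 => if i == ord0 then a else b).
move: gE; rewrite big_ord_recl big_ord1 /= => gE.
exists g, (r ord0), (r (lift ord0 ord0)), (u' ord0), (u' (lift ord0 ord0)).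
by split=> //; [rewrite -(uE ord0) | rewrite -(uE (lift ord0 ord0))].
Qed.

Lemma bezout2_comax (a b : R) : a != 0 ->
  exists g a' b' : R, [/\ g != 0, a = a' * g, b = b' * g & comax a' b'].
Proof.
move=> a0; have [g [p [q [a' [b' [gE aE bE]]]]]] := bezout2 a b.
have g0 : g != 0 by apply: contraNneq a0 => g0; rewrite aE g0 mulr0.
exists g, a', b'; split=> //; exists p, q; apply: (mulIf g0).
by rewrite mulrDl -!mulrA -aE -bE mul1r.
Qed.

(** The coprime part [j] generates the saturation of the ideal (h) by the powers
    of [x].  As all ideals are principal, this takes the place of a
    factorization of [h] into primes. *)
Lemma coprime_part (x h : R) : h != 0 ->
  exists j b N, [/\ h = b * j, comax j x & exists w, x ^+ N = b * w].
Proof.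
move=> h0; pose I (y : R) := exists N w, y * x ^+ N = h * w.
have /R_pid[j jP] : is_ideal I.
  split.
  - by exists 0%N, 0; rewrite mul0r mulr0.
  - move=> y1 y2 [N1 [w1 e1]] [N2 [w2 e2]].
    exists (N1 + N2)%N, (w1 * x ^+ N2 + w2 * x ^+ N1).
    by rewrite exprD mulrDl mulrA e1 mulrCA e2; ring.
  - by move=> a y [N [w e]]; exists N, (a * w); rewrite -mulrA e mulrCA.
have /jP[b hE] : I h by exists 0%N, 1.
have /jP[N [w jE]] : exists a, j = a * j by exists 1; rewrite mul1r.
have j0 : j != 0 by apply: contraNneq h0 => j0; rewrite hE j0 mulr0.
exists j, b, N; split=> //; last first.
  by exists w; apply: (mulfI j0); rewrite jE hE; ring.
have [d [j' [x' [d0 j'E x'E [p [q pq]]]]]] := bezout2_comax x j0.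
have /jP[a aE] : I j'.
  exists N.+1, (w * x'); rewrite exprS.
  transitivity (x' * ((j' * d) * x ^+ N)); first by rewrite {1}x'E; ring.
  by rewrite -j'E jE; ring.
have j'0 : j' != 0 by apply: contraNneq j0 => j'0; rewrite j'E j'0 mul0r.
have ad1 : a * d = 1 by apply: (mulfI j'0); rewrite mulr1 {2}aE j'E; ring.
exists (a * p), (a * q).
transitivity (a * d * (p * j' + q * x')); last by rewrite pq ad1 mulr1.
by rewrite {1}j'E {1}x'E; ring.
Qed.

(** A unit modulo [y] has a representative coprime to any prescribed [h]: with
    [j] the part of [h] coprime to [x], a prime factor of [h] divides exactly
    one of the two terms of [x + j * y]. *)
Lemma comax_shift (x y h : R) : h != 0 -> comax x y ->
  exists j, comax (x + j * y) h.
Proof.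
move=> h0 xy; have [j [b [N [-> jx [w xN]]]]] := coprime_part x h0.
exists j; apply: comaxMr; last first.
  by rewrite [j * y]mulrC; apply: comax_addMl; apply: comaxC.
apply: (@comax_dvdr _ _ _ w); rewrite -xN; apply: comaxXr.
rewrite addrC -{1}[x]mul1r; apply: comax_addMl.
by apply: comaxC; apply: comaxMr => //; apply: comaxC.
Qed.

(** The relation that makes the trace of [X *m A] vanish, with the constraint
    that neighbouring [s i] be inverse modulo [c].

    If the sums of the [u i] over even and over odd [i] both vanish, then
    [c = 0] and [s = 1] work.  Otherwise, let [g] be the gcd of the [u i] and
    let [d] be that of [g] and [T]; write [u i = u' i * g], [g = g' * d] and
    [T = T' * d].  With [c = g' * k], the relation becomes
    [\sum_i s i * u' i = - k * T'].  It is enough to solve it modulo [c], since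
    the [u' i] generate the unit ideal.  Let the [s i] be alternately [e] and
    its inverse [f] modulo [c], and let [rho] and [tau] be the matching partial
    sums of the [u' i], with [tau] nonzero; the left side is then congruent to
    [f * (e ^+ 2 * rho + tau)].  So put [k = e ^+ 2 * rho + tau]; what remains is
    that [f] be congruent to [- T'] modulo [g'].  This prescribes [e] modulo
    [g'], and [comax_shift] makes it coprime to [tau] as well, hence to [k] and
    to [c]. *)
Lemma superdiag_relation (m : nat) (T : R) (u : 'I_m -> R) :
  exists (c : R) (s z : nat -> R),
    c * T + \sum_(i < m) s i * u i = 0 /\
    forall i, s i * s i.+1 = 1 + c * z i.
Proof.
pose S (v : 'I_m -> R) b := \sum_(i < m | odd i == b) v i.
have SE v b : \sum_i v i = S v b + S v (~~ b).
  rewrite (bigID (fun i : 'I_m => odd i == b)) /=; congr (_ + _).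
  by apply: eq_bigl => i; case: (odd i) b => [] [].
have [S0|[b Sb0]] : (forall b, S u b = 0) \/ exists b, S u b != 0.
  have [t0|] := eqVneq (S u true) 0; last by right; exists true.
  have [f0|] := eqVneq (S u false) 0; last by right; exists false.
  by left=> -[].
  exists 0, (fun=> 1), (fun=> 0); split; last by move=> i; ring.
  rewrite mul0r add0r (eq_bigr u) => [|i _]; last by rewrite mul1r.
  by rewrite (SE u true) !S0 addr0.
have [g [r [u' [gE uE]]]] := bezout u.
have SuE a : S u a = S u' a * g.
  by rewrite /S mulr_suml; apply: eq_bigr => i _; rewrite uE.
have g0 : g != 0 by apply: contraNneq Sb0 => g0; rewrite SuE g0 mulr0.
have ru1 : \sum_i r i * u' i = 1.
  apply: (mulIf g0); rewrite mul1r {2}gE mulr_suml.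
  by apply: eq_bigr => i _; rewrite uE mulrA.
set tau := S u' b; set rho := S u' (~~ b).
have tau0 : tau != 0.
  by apply: contraNneq Sb0 => t0; rewrite SuE -/tau t0 mul0r.
have [d [g' [T' [d0 gE' TE [p [t pt]]]]]] := bezout2_comax T g0.
(* [- t] is the inverse of [- T'] modulo [g']. *)
have [j ej] : exists j, comax (- t + j * g') tau.
  by apply: comax_shift => //; exists (- T'), p; rewrite -pt; ring.
set e := - t + j * g' in ej.
pose k := e ^+ 2 * rho + tau; pose c := g' * k.
have [f [q1 fq]] : comax e c.
  apply: comaxMr.
    by apply: comax_addMl; exists (- T'), p; rewrite -pt; ring.
  apply: comaxC; rewrite /k addrC expr2 mulrAC; apply: comax_addMl.
  exact: comaxC.
pose z0 := - q1.
have ef : e * f = 1 + c * z0 by rewrite -fq /z0; ring.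
pose w := f * p + f * j * T' - k * z0 * T'.
have fT : f + T' = g' * w.
  transitivity (f * (p * g' + t * T') + T'); first by rewrite pt mulr1.
  transitivity (f * p * g' + f * j * g' * T' - (e * f) * T' + T').
    by rewrite /e; ring.
  by rewrite ef /w /c; ring.
pose M := w - z0 * e * rho.
have relM : e * rho + f * tau + k * T' = c * M.
  transitivity ((1 + c * z0) * e * rho + f * tau + k * T' - c * z0 * e * rho).
    by ring.
  transitivity (k * (f + T') - c * z0 * e * rho).
    by rewrite -ef /k; ring.
  by rewrite fT /M /c; ring.
(* Subtracting [c * M] times the Bezout coefficients [r] turns the congruence
   into an equality and preserves the residues of the [s0 i] modulo [c]. *)
pose r' i := if insub i is Some i' then r i' else 0.
have r'E (i : 'I_m) : r' i = r i by rewrite /r' valK.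
pose s0 i := if odd i == b then f else e.
exists c, (fun i => s0 i - c * M * r' i).
exists (fun i => z0 - M * r' i * s0 i.+1 - M * s0 i * r' i.+1
                 + c * M ^+ 2 * r' i * r' i.+1).
split=> [|i]; last first.
  have s0E : s0 i * s0 i.+1 = 1 + c * z0.
    by rewrite -ef /s0 /=; case: (odd i); case: (b) => //=; rewrite mulrC.
  transitivity (s0 i * s0 i.+1 - c * M * r' i * s0 i.+1
    - c * M * s0 i * r' i.+1 + (c * M) ^+ 2 * r' i * r' i.+1); first by ring.
  by rewrite s0E; ring.
have s0u' : \sum_(i < m) s0 i * u' i = e * rho + f * tau.
  rewrite (SE _ b) addrC; congr (_ + _); rewrite /rho /tau /S mulr_sumr.
    by apply: eq_bigr => i ib; rewrite /s0; case: (odd i) ib; case: (b).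
  by apply: eq_bigr => i ib; rewrite /s0 ib.
transitivity (c * T + (\sum_(i < m) s0 i * u' i - c * M * \sum_i r i * u' i) * g).
  congr (_ + _); rewrite mulr_sumr -sumrB mulr_suml.
  by apply: eq_bigr => i _; rewrite uE r'E; ring.
by rewrite ru1 s0u' mulr1 -relM gE' TE /c; ring.
Qed.

End PID.

(** * Reduction to Hessenberg form *)

Definition hessenberg (R : pzRingType) (n : nat) (A : 'M[R]_n) :=
  forall i j : 'I_n, (i + 2 <= j)%N -> A i j = 0.

Lemma row_clear2 (R : idomainType) (R_pid : is_PID R) (v : 'rV[R]_2) :
  exists2 G, G \in unitmx & (v *m G) 0 ord_max = 0.
Proof.
set a := v 0 0; set b := v 0 ord_max.
have [g [p [q [a' [b' [gE aE bE]]]]]] := bezout2 R_pid a b.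
have [g0|g0] := eqVneq g 0.
  by exists 1%:M; rewrite ?unitmx1 // mulmx1 -/b bE g0 mulr0.
pose G : 'M[R]_2 := \matrix_(i, j)
  if i == 0 then (if j == 0 then p else - b') else (if j == 0 then q else a').
exists G; last first.
  rewrite mxE big_ord_recl big_ord1 !mxE /=.
  rewrite (_ : lift _ _ = ord_max) -/a -/b; last exact/val_inj.
  by rewrite [X in X * _]aE [X in _ + X * _]bE; ring.
have pq : p * a' + q * b' = 1.
  by apply: (mulIf g0); rewrite mul1r [RHS]gE [in RHS]aE [in RHS]bE; ring.
pose G' : 'M[R]_2 := \matrix_(i, j)
  if i == 0 then (if j == 0 then a' else b') else (if j == 0 then - q else p).
suff /mulmx1_unit[] : G *m G' = 1%:M by [].
apply/matrixP => i j; rewrite mxE big_ord_recl big_ord1 !mxE /=.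
by case: i j => [[|[|//]] ?] [[|[|//]] ?] /=; rewrite ?mulr1n ?mulr0n -?pq; ring.
Qed.

Lemma row_clear (R : idomainType) (R_pid : is_PID R) (m : nat) (r : 'rV[R]_(1 + m)) :
  exists2 U, U \in unitmx & forall j, j != 0 -> (r *m U) 0 j = 0.
Proof.
elim: m r => [|m IHm] r.
  by exists 1%:M; rewrite ?unitmx1 // => j; rewrite (ord1 j).
pose r1 : 'rV[R]_(1 + (1 + m)) := r.
have [U Uu rU] := IHm (rsubmx r1).
pose V : 'M[R]_(1 + (1 + m)) := block_mx 1%:M 0 0 U.
have Vu : V \in unitmx by rewrite unitmxE det_ublock det1 mul1r -unitmxE.
(* Reading 1 + (1 + m) as 2 + m lets the 2 x 2 case finish the row. *)
pose w : 'rV[R]_(2 + m) := r1 *m V.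
have wE : rsubmx w = 0.
  apply/rowP => j; rewrite [LHS]mxE [RHS]mxE.
  have -> : w = row_mx (lsubmx r1) (rsubmx r1 *m U).
    by rewrite /w /V -{1}[r1]hsubmxK mul_row_block !mulmx0 mulmx1 addr0 add0r.
  have -> : rshift 2 j = rshift 1 (lift 0 j) :> 'I_(1 + (1 + m)) by apply/val_inj.
  by rewrite -(rU (lift 0 j)) //; exact: (row_mxEr (lsubmx r1)).
have [G Gu wG] := row_clear2 R_pid (lsubmx w).
pose V2 : 'M[R]_(2 + m) := block_mx G 0 0 1%:M.
have V2u : V2 \in unitmx by rewrite unitmxE det_ublock det1 mulr1 -unitmxE.
exists (V *m V2); first by rewrite unitmx_mul Vu V2u.
have rE : r *m (V *m V2) = row_mx (lsubmx w *m G) 0.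
  transitivity (row_mx (lsubmx w) (0 : 'rV_m) *m V2).
    by rewrite -wE hsubmxK /w -mulmxA.
  by rewrite mul_row_block !mulmx0 mul0mx !addr0.
move=> j j0; rewrite rE.
have [k jk|k jk] := @split_ordP 2 m j; rewrite jk; first last.
  by apply: etrans (row_mxEr (lsubmx w *m G) 0 0 k) _; rewrite mxE.
apply: etrans (row_mxEl (lsubmx w *m G) 0 0 k) _.
rewrite (_ : k = ord_max) //; apply/val_inj => /=.
by have := ltn_ord k; move: j0; rewrite jk -val_eqE /=; lia.
Qed.

(** The base change fixes the first basis vector, which is what lets the
    induction proceed: clearing the first row with [U] leaves it unaffected by
    the later base changes, since they act on the remaining coordinates and fix
    the first of those. *)
Lemma hessenberg_reduction (R : idomainType) (R_pid : is_PID R) (m : nat)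
    (A : 'M[R]_(1 + m)) : exists2 U : 'M[R]_m, U \in unitmx &
  hessenberg (block_mx 1%:M 0 0 (invmx U) *m A *m block_mx 1%:M 0 0 U).
Proof.
elim: m A => [|m IHm] A.
  by exists 1%:M; rewrite ?unitmx1 // => i j; have := ltn_ord j; lia.
have [U Uu rU] := row_clear R_pid (ursubmx A).
have [U2 U2u hD] := IHm (invmx U *m drsubmx A *m U).
pose V : 'M[R]_(1 + m) := block_mx 1%:M 0 0 U2.
have Vu : V \in unitmx by rewrite unitmxE det_ublock det1 mul1r -unitmxE.
have iV : invmx V = block_mx 1%:M 0 0 (invmx U2).
  rewrite -[RHS]mulmx1 -(mulmxV Vu) mulmxA.
  rewrite [X in X *m invmx V](_ : _ = 1%:M) ?mul1mx // /V mulmx_block.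
  rewrite !(mul1mx, mulmx1, mul0mx, mulmx0, addr0, add0r) mulVmx //.
  by rewrite -scalar_mx_block.
exists (U *m V); first by rewrite unitmx_mul Uu Vu.
have -> : invmx (U *m V) = invmx V *m invmx U.
  rewrite -[RHS]mulmx1 -(@mulmxV _ _ (U *m V)) ?unitmx_mul ?Uu //.
  by rewrite !mulmxA mulmxKV // mulVmx // mul1mx.
rewrite -[A]submxK !mulmx_block.
rewrite !(mul1mx, mulmx1, mul0mx, mulmx0, addr0, add0r).
have -> : ursubmx A *m (U *m V) = ursubmx A *m U.
  rewrite mulmxA -[ursubmx A *m U]hsubmxK /V mul_row_block.
  have -> : rsubmx (ursubmx A *m U) = 0.
    by apply/rowP => j; rewrite [LHS]mxE rU // mxE.
  by rewrite !(mulmx1, mulmx0, mul0mx, addr0).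
have -> : invmx V *m invmx U *m drsubmx A *m (U *m V) =
    invmx V *m (invmx U *m drsubmx A *m U) *m V by rewrite !mulmxA.
rewrite iV => i j.
have [i' ->|i' ->] := @split_ordP 1 m.+1 i;
  have [j' ->|j' ->] := @split_ordP 1 m.+1 j.
- by move=> /=; have := ltn_ord j'; lia.
- rewrite /= ord1 /= => j'1; rewrite block_mxEur rU //.
  by rewrite -val_eqE /=; lia.
- by move=> /=; have := ltn_ord j'; lia.
- by move=> /= ij; rewrite block_mxEdr; apply: hD.
Qed.

(** * Commutators with a bidiagonal matrix *)

Section Bidiag.
Variables (R : comPzRingType) (n : nat) (d : nat -> R).

Definition bidiag : 'M[R]_n :=
  \matrix_(i, j) if i == j then d j else (i == j.+1 :> nat)%:R.

(** The convention [F n = 0] treats the last column, which has no entry below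
    the diagonal, like the others. *)
Lemma sum_bidiag (F : nat -> R) (j : 'I_n) : F n = 0 ->
  \sum_(k < n) F k * bidiag k j = F j * d j + F j.+1.
Proof.
move=> Fn; rewrite (bigD1 j) //= mxE eqxx; congr (_ + _).
have [jn|jn] := ltnP j.+1 n.
  rewrite (bigD1 (Ordinal jn)) /=; last by rewrite -val_eqE /= gtn_eqF.
  rewrite mxE -val_eqE /= gtn_eqF // eqxx mulr1 big1 ?addr0 // => k /andP[kj kj1].
  by rewrite mxE (negPf kj) (_ : _ == _ = false) ?mulr0 //; exact: negPf kj1.
rewrite (_ : j.+1 = n) ?Fn; last by have := ltn_ord j; lia.
rewrite big1 // => k kj; rewrite mxE (negPf kj).
by rewrite (_ : _ == _ = false) ?mulr0 //; have := ltn_ord k; lia.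
Qed.

Lemma bidiag_row (b : 'cV[R]_n) (i j : 'I_n) : j = i.+1 :> nat ->
  (bidiag *m b) j 0 = d j * b j 0 + b i 0.
Proof.
move=> ji; rewrite mxE (bigD1 j) //= mxE eqxx; congr (_ + _).
rewrite (bigD1 i) /=; last by rewrite -val_eqE /= ji ltn_eqF.
rewrite mxE -val_eqE /= ji gtn_eqF // eqxx mul1r big1 ?addr0 // => k /andP[kj ki].
rewrite mxE eq_sym (negPf kj) (_ : _ == _ = false) ?mul0r //.
by apply: contraNF ki => /eqP e; apply/eqP/val_inj => /=; lia.
Qed.

(** The last coordinates of the iterates determine [b], because the ones below
    the diagonal make the last coordinate of [bidiag ^+ r *m b] see [b] one step
    further up for each increase of [r]. *)
Lemma bidiag_observable (b : 'cV[R]_n) (l : 'I_n) : l.+1 = n ->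
  (forall r, (bidiag ^+ r *m b) l 0 = 0) -> b = 0.
Proof.
move=> ln bl.
suff H k : forall i : 'I_n, (i + k)%N = l -> forall r, (bidiag ^+ r *m b) i 0 = 0.
  apply/matrixP => i j; rewrite ord1 mxE -[b]mul1mx.
  by apply: (H (l - i)%N i _ 0%N); have := ltn_ord i; lia.
elim: k => [|k IHk] i ik r.
  by rewrite (_ : i = l) //; apply/val_inj => /=; lia.
have i1n : (i.+1 < n)%N by lia.
have ik1 : (Ordinal i1n + k)%N = l by rewrite /=; lia.
have := IHk _ ik1 r.+1; rewrite exprS -mulmxE -mulmxA (@bidiag_row _ i) //.
by rewrite (IHk _ ik1) mulr0 add0r.
Qed.

End Bidiag.

Lemma mxtrace_comm_pow (R : comPzRingType) (n r : nat) (X Y : 'M[R]_n) :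
  \tr (X ^+ r *m mx_comm X Y) = 0.
Proof.
rewrite /mx_comm mulmxBr raddfB /= [in X in _ - X]mulmxA.
by rewrite [X in _ - X]mxtrace_mulC !mulmxA !mulmxE -exprS -exprSr subrr.
Qed.

(** The equation [B = mx_comm H Z] determines each column of [Z] from the one
    before it.  Solving from a zero first column makes all columns agree except
    possibly the last one, and the trace conditions are then those of
    [bidiag_observable] for the error in that column. *)
Lemma bidiag_comm (R : comPzRingType) (n : nat) (d : nat -> R) (B : 'M[R]_n.+1) :
  (forall r, \tr (bidiag n.+1 d ^+ r *m B) = 0) ->
  exists Z, B = mx_comm (bidiag n.+1 d) Z.
Proof.
move=> trB; set H := bidiag _ _ in trB *.
pose zc := fix zc j : 'cV[R]_n.+1 := if j is k.+1
  then H *m zc k - d k *: zc k - col (inord k) B else 0.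
have zcS k : zc k.+1 = H *m zc k - d k *: zc k - col (inord k) B by [].
move: zc zcS => zc zcS.
pose Z := \matrix_(i < n.+1, j < n.+1) zc j i 0.
pose b := zc n.+1.
pose E := \matrix_(i < n.+1, j < n.+1) if j == ord_max then b i 0 else 0.
have EB : E = mx_comm H Z - B.
  apply/matrixP => i j.
  pose F (k : nat) := if (k < n.+1)%N then zc k i 0 else 0.
  have ZH : (Z *m H) i j = zc j i 0 * d j + F j.+1.
    have := @sum_bidiag _ n.+1 d F j; rewrite {1}/F ltnn {2}/F ltn_ord => <- //.
    by rewrite mxE; apply: eq_bigr => k _; rewrite mxE /F ltn_ord.
  have HZ : (H *m Z) i j = (H *m zc j) i 0.
    by rewrite !mxE; apply: eq_bigr => k _; rewrite [Z _ _]mxE.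
  have zS : zc j.+1 i 0 = (H *m zc j) i 0 - d j * zc j i 0 - B i j.
    by rewrite zcS; move: (H *m zc j) => P; rewrite !mxE inord_val.
  rewrite /mx_comm; move: (H *m Z) (Z *m H) HZ ZH => P Q HZ ZH.
  rewrite /E !mxE HZ ZH /F ltnS.
  have [jn|jn] := eqVneq j ord_max.
    have -> : b = zc j.+1 by rewrite jn.
    by rewrite zS jn /= ltnn; ring.
  have -> : (j < n)%N by move: jn (ltn_ord j); rewrite -val_eqE /=; lia.
  by rewrite zS; ring.
have b0 : b = 0.
  apply: (@bidiag_observable _ _ d b ord_max) => // r; rewrite -/H.
  transitivity (\tr (H ^+ r *m E)).
    rewrite /mxtrace (bigD1 ord_max) //= [X in _ + X]big1 ?addr0 => [|i im].
      by rewrite !mxE; apply: eq_bigr => k _; rewrite !mxE eqxx.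
    by rewrite mxE big1 // => k _; rewrite !mxE (negPf im) mulr0.
  by rewrite EB mulmxBr raddfB /= trB mxtrace_comm_pow subr0.
exists Z; apply/eqP; rewrite eq_sym -subr_eq0 -EB; apply/eqP/matrixP => i j.
by rewrite !mxE b0 mxE if_same.
Qed.

(** If [K] were invertible, conjugation by [K] would carry the criterion from [H]
    to [X].  With the adjugate in place of the inverse the same computation
    costs the factor [(\det K) ^+ 2]. *)
Lemma intertwined_comm (R : idomainType) (n : nat) (X H K A : 'M[R]_n) :
  X *m K = K *m H ->
  (forall B : 'M[R]_n, (forall r, \tr (H ^+ r *m B) = 0) ->
    exists Z, B = mx_comm H Z) ->
  (forall r, \tr (X ^+ r *m A) = 0) ->
  exists Y, (\det K) ^+ 2 *: A = mx_comm X Y.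
Proof.
move=> XK Hcomm trA; set D := \det K.
have [D0|D0] := eqVneq D 0.
  by exists 0; rewrite /mx_comm D0 expr0n scale0r mulmx0 mul0mx subrr.
pose L := \adj K.
have LX : L *m X = H *m L.
  suff : D *: (L *m X) = D *: (H *m L).
    move: (L *m X) (H *m L) => P Q /matrixP PQ; apply/matrixP => i j.
    by apply: (mulfI D0); move: (PQ i j); rewrite !mxE.
  rewrite -mul_mx_scalar -mul_mx_adj -/L -[L *m X *m _]mulmxA [X *m _]mulmxA XK.
  by rewrite !mulmxA mul_adj_mx -mulmxA mul_scalar_mx.
have LXr r : L *m X ^+ r = H ^+ r *m L.
  elim: r => [|r IHr]; first by rewrite mulmx1 mul1mx.
  by rewrite exprSr -mulmxE mulmxA IHr -mulmxA LX mulmxA mulmxE -exprSr.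
have [r|Z BZ] := Hcomm (L *m A *m K).
  rewrite !mulmxA -LXr mxtrace_mulC !mulmxA mul_mx_adj -!mulmxA mul_scalar_mx.
  by rewrite mxtraceZ trA mulr0.
exists (K *m Z *m L).
transitivity (K *m (L *m A *m K) *m L).
  rewrite !mulmxA mul_mx_adj -!mulmxA mul_mx_adj mul_scalar_mx.
  by rewrite mul_mx_scalar scalerA.
rewrite BZ /mx_comm mulmxBr mulmxBl !mulmxA -XK.
by rewrite -[X in _ - X]mulmxA -LX !mulmxA.
Qed.

Lemma comm_comb (R : comPzRingType) (n : nat) (a b : R) (X A Y1 Y2 : 'M[R]_n) :
  comax a b -> a *: A = mx_comm X Y1 -> b *: A = mx_comm X Y2 ->
  exists Y, A = mx_comm X Y.
Proof.
move=> [p [q pq]] e1 e2; exists (p *: Y1 + q *: Y2).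
rewrite -[LHS]scale1r -pq scalerDl -!scalerA e1 e2 /mx_comm.
rewrite mulmxDr mulmxDl -!scalemxAl -!scalemxAr !scalerBr.
by rewrite opprD addrACA.
Qed.

(** * Matrices supported below a diagonal *)

(** On a column vector this says that the first [k] coordinates vanish, so the
    lemmas below cover both matrix products and the action on vectors. *)
Definition band (R : pzRingType) (m n : nat) (k : nat) (M : 'M[R]_(m, n)) :=
  forall (i : 'I_m) (j : 'I_n), (i < j + k)%N -> M i j = 0.

Lemma band_mul (R : pzRingType) (m n p a b : nat) (M : 'M[R]_(m, n))
    (N : 'M[R]_(n, p)) : band a M -> band b N -> band (a + b) (M *m N).
Proof.
move=> Ma Nb i j ij; rewrite mxE big1 // => k _.
have [ik|ik] := ltnP i (k + a); first by rewrite Ma ?mul0r.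
by rewrite Nb ?mulr0 //; lia.
Qed.

(** On the first diagonal that can be nonzero, a single term of the product
    survives. *)
Lemma band_mul_lead (R : pzRingType) (m n p a b : nat) (M : 'M[R]_(m, n))
    (N : 'M[R]_(n, p)) (i : 'I_m) (k : 'I_n) (j : 'I_p) :
  band a M -> band b N -> i = (k + a)%N :> nat -> k = (j + b)%N :> nat ->
  (M *m N) i j = M i k * N k j.
Proof.
move=> Ma Nb ik kj; rewrite mxE (bigD1 k) //= big1 ?addr0 // => l lk.
have {}lk : l != k :> nat by [].
have [il|il] := ltnP i (l + a); first by rewrite Ma ?mul0r.
by rewrite Nb ?mulr0 //; lia.
Qed.

Lemma band_weaken (R : pzRingType) (m n a b : nat) (M : 'M[R]_(m, n)) :
  (b <= a)%N -> band a M -> band b M.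
Proof. by move=> ba Ma i j ij; apply: Ma; lia. Qed.

Lemma bandD (R : pzRingType) (m n a : nat) (M N : 'M[R]_(m, n)) :
  band a M -> band a N -> band a (M + N).
Proof. by move=> Ma Na i j ij; rewrite mxE Ma ?Na ?addr0. Qed.

Lemma band_diag (R : pzRingType) (n : nat) (d : 'rV[R]_n) : band 0 (diag_mx d).
Proof.
by move=> i j ij; rewrite mxE; case: eqP => [e|]; [move: ij; rewrite e; lia|].
Qed.

Lemma band_scalar (R : pzRingType) (n : nat) (a : R) : band 0 (a%:M : 'M_n).
Proof. by rewrite -diag_const_mx; apply: band_diag. Qed.

Lemma trace_band_hessenberg (R : pzRingType) (n : nat) (M A : 'M[R]_n) :
  band 2 M -> hessenberg A -> \tr (M *m A) = 0.
Proof.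
move=> M2 hA; rewrite /mxtrace big1 // => i _; rewrite mxE big1 // => k _.
have [ik|ik] := ltnP i (k + 2); first by rewrite M2 ?mul0r.
by rewrite hA ?mulr0.
Qed.

(** * The matrix X *)

Section AltMatrix.
Variables (R : comPzRingType) (n : nat) (c : R) (s z : nat -> R).
Hypothesis sz : forall i, s i * s i.+1 = 1 + c * z i.

(** The diagonal of [altX]; the two values are the roots of [x ^+ 2 - c * x]. *)
Definition alt (i : nat) : R := if odd i then c else 0.
Definition diagX : 'M[R]_n := diag_mx (\row_i alt i).

(** The sign on the second subdiagonal compensates that the difference of the
    two eigenvalues of [altX] changes sign from one row to the next; it is what
    makes [altW_lead] hold in all rows. *)
Definition strictX : 'M[R]_n := \matrix_(i, j)
  if i == j.+1 :> nat then s j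
  else if i == j.+2 :> nat then (-1) ^+ odd j * z j else 0.

Definition altX := diagX + strictX.
Definition altW := altX *m altX - c *: altX.

Lemma alt_sqr i : alt i * alt i = c * alt i.
Proof. by rewrite /alt; case: odd; ring. Qed.

Lemma altS i : alt i + alt i.+1 = c.
Proof. by rewrite /alt /=; case: odd; rewrite ?addr0 ?add0r. Qed.

Lemma band_strictX : band 1 strictX.
Proof. by move=> i j ij; rewrite mxE; do 2 (case: eqP; first lia). Qed.

Lemma band_altX : band 0 altX.
Proof. by apply: bandD; [apply: band_diag|apply: band_weaken band_strictX]. Qed.

Lemma altWE i j :
  altW i j = (alt i + alt j - c) * strictX i j + (strictX *m strictX) i j.
Proof.
have WE : altW = diagX *m diagX + diagX *m strictX
    + (strictX *m diagX + strictX *m strictX)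
    - c *: (diagX + strictX).
  by rewrite /altW /altX mulmxDl !mulmxDr.
rewrite WE; set SS := strictX *m strictX; rewrite /diagX mul_diag_mx mul_mx_diag.
move: SS => SS; rewrite mul_diag_mx; set S := strictX; rewrite !mxE.
have [->|ij] := eqVneq i j.
  rewrite !mulr1n mulrDr alt_sqr; ring.
rewrite !mulr0n; ring.
Qed.

Lemma band_altW : band 2 altW.
Proof.
move=> i j ij; rewrite altWE (band_mul band_strictX band_strictX ij) addr0.
have [ij1|ij1] := eqVneq (i : nat) j.+1.
  by rewrite ij1 [_ + alt j]addrC altS subrr mul0r.
by rewrite band_strictX ?mulr0 //; lia.
Qed.

(** The entry is [s j * s j.+1 - c * z j], which the congruence between
    neighbouring [s i] makes equal to 1. *)
Lemma altW_lead (i j : 'I_n) : i = (j + 2)%N :> nat -> altW i j = 1.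
Proof.
move=> ij; have j1n : (j.+1 < n)%N by have := ltn_ord i; lia.
rewrite altWE (@band_mul_lead _ _ _ _ 1 1 _ _ i (Ordinal j1n) j) //=;
  try exact: band_strictX; try lia.
rewrite !mxE /= ij !eqxx addn2 eqxx gtn_eqF //.
rewrite mulrC [s _ * _]mulrC sz /alt /= negbK; case: odd => /=; ring.
Qed.

End AltMatrix.

(** * The trace conditions *)

Section Powers.
Variables (R : comPzRingType) (n : nat) (c : R) (s z : nat -> R).
Notation X := (altX n c s z).
Notation W := (altW n c s z).

(** Comes from [X ^+ 2 = c *: X + W]; it leaves [\tr A] and [\tr (X *m A)] as the
    only trace conditions for a Hessenberg matrix [A]. *)
Lemma altX_powE r : exists2 Q : 'M[R]_n, band 0 Q & X ^+ r.+1 = c ^+ r *: X + W *m Q.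
Proof.
have XX : X *m X = c *: X + W by rewrite addrC subrK.
elim: r => [|r [Q Q0 XE]].
  by exists 0; [move=> i j _; rewrite mxE | rewrite mulmx0 addr0 scale1r].
exists ((c ^+ r)%:M + Q *m X).
  apply: bandD; first exact: band_scalar.
  exact: (band_mul Q0 (@band_altX _ _ _ _ _)).
rewrite exprSr XE -mulmxE mulmxDl -scalemxAl XX scalerDr scalerA -exprSr.
by rewrite mulmxDr mul_mx_scalar mulmxA addrA.
Qed.

Lemma trace_altX_pow (A : 'M[R]_n) : hessenberg A -> \tr A = 0 -> \tr (X *m A) = 0 ->
  forall r, \tr (X ^+ r *m A) = 0.
Proof.
move=> hA tA tXA [|r]; first by rewrite mul1mx.
have [Q Q0 ->] := altX_powE r.
rewrite mulmxDl mxtraceD -scalemxAl mxtraceZ tXA mulr0 add0r.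
apply: trace_band_hessenberg => //; exact: (band_mul (@band_altW _ _ _ _ _) Q0).
Qed.

End Powers.

Lemma trace_altX_mul (R : comPzRingType) (m : nat) (c : R) (s z : nat -> R)
    (A : 'M[R]_m.+1) :
  hessenberg A ->
  \tr (altX m.+1 c s z *m A) =
  c * (\sum_(i < m.+1 | odd i) A i i) +
  \sum_(i < m) s i * A (inord i) (inord i.+1).
Proof.
move=> hA; rewrite /altX mulmxDl mxtraceD; congr (_ + _).
  rewrite /diagX mul_diag_mx /mxtrace mulr_sumr [RHS]big_mkcond /=.
  by apply: eq_bigr => i _; rewrite !mxE /alt; case: odd; rewrite ?mul0r.
have last0 : (A *m strictX m.+1 s z) ord_max ord_max = 0.
  rewrite mxE big1 // => k _; rewrite mxE /=; have km := ltn_ord k.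
  by do 2 (case: eqP; first lia); rewrite mulr0.
rewrite mxtrace_mulC /mxtrace big_ord_recr /= last0 addr0.
apply: eq_bigr => i _; rewrite mxE (bigD1 (inord i.+1)) //= big1 ?addr0 => [|k ki].
  rewrite mulrC; congr (_ * _).
    by rewrite mxE /= inordK // ?eqxx //; have := ltn_ord i; lia.
  by congr (A _ _); apply/val_inj; rewrite /= inordK //; have := ltn_ord i; lia.
have ki1 : (k : nat) != i.+1.
  by apply: contraNneq ki => e; rewrite -e inord_val.
rewrite mxE /= (negPf ki1); case: eqP => [e|]; last by rewrite mulr0.
by rewrite hA ?mul0r //= e; lia.
Qed.

(** * The Krylov matrix intertwining X with a bidiagonal matrix *)

Section Krylov.
Variables (R : comPzRingType) (n : nat) (c : R) (s z : nat -> R).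
Hypothesis sz : forall i, s i * s i.+1 = 1 + c * z i.
Variables a b : R.
Notation X := (altX n c s z).
Notation W := (altW n c s z).

Definition start : 'cV[R]_n :=
  \col_i (if i == 0 :> nat then a else if i == 1 :> nat then b else 0).

(** The powers of [X] in the usual Krylov sequence are replaced by the products
    1, X, W, W X, W ^+ 2, ... of the same degrees: the [m]-th vector then vanishes
    before its coordinate [m], so that the matrix of these vectors is
    triangular. *)
Definition krylov (m : nat) : 'cV[R]_n := W ^+ m./2 *m (X ^+ odd m *m start).

Lemma krylovSS m : krylov m.+2 = W *m krylov m.
Proof. by rewrite /krylov /= negbK exprS -mulmxE !mulmxA. Qed.

Lemma X_krylov m : X *m krylov m = alt c m *: krylov m + krylov m.+1.
Proof.
have XW k : X *m W ^+ k = W ^+ k *m X.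
  apply: commrX; rewrite /altW; apply: commrB; first exact: commrM.
  by rewrite /GRing.comm -!mulmxE -scalemxAl -scalemxAr.
rewrite /krylov /alt mulmxA XW -mulmxA /= uphalf_half.
case: odd; last by rewrite scale0r add0r mul1mx.
rewrite /= !expr1 expr0 add1n exprSr mul1mx -mulmxE [X *m (X *m _)]mulmxA.
rewrite (_ : X *m X = c *: X + W); last by rewrite addrC subrK.
by rewrite mulmxDl mulmxDr -scalemxAl -scalemxAr mulmxA.
Qed.

Lemma X_start : band 1 (X *m start) /\
  forall i : 'I_n, i = 1 :> nat -> (X *m start) i 0 = a * s 0 + b * c.
Proof.
have st0 : band 0 start by move=> i j; rewrite ord1 /= addn0.
have E i : (X *m start) i 0 = alt c i * start i 0 + (strictX n s z *m start) i 0.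
  rewrite /altX mulmxDl /diagX mul_diag_mx.
  by move: (strictX n s z *m start) => P; rewrite !mxE.
have S1 := band_mul (@band_strictX _ n s z) st0.
split=> [i j|i i1].
  rewrite ord1 => i0; rewrite E S1 // addr0.
  by rewrite (_ : i = 0%N :> nat) ?mul0r //; move: i0; rewrite /=; lia.
have n0 : (0 < n)%N by have := ltn_ord i; lia.
rewrite E (@band_mul_lead _ _ _ _ 1 0 _ _ i (Ordinal n0) 0) //;
  last exact: band_strictX.
by rewrite !mxE /= i1 /alt /=; ring.
Qed.

Definition lead (m : nat) : R := if odd m then a * s 0 + b * c else a.

Lemma krylov_lead m : band m (krylov m) /\
  forall i : 'I_n, i = m :> nat -> krylov m i 0 = lead m.
Proof.
elim/ltn_ind: m => -[|[|m]] IHm.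
- split=> [i j|i i0]; first by rewrite ord1 /= addn0.
  by rewrite /krylov !mul1mx mxE i0.
- by have := X_start; rewrite /krylov /= mul1mx expr1.
have [bm lm] := IHm m (leqnSn _); rewrite krylovSS.
split=> [|i im]; first exact: (band_mul (@band_altW _ _ _ _ _) bm).
have mn : (m < n)%N by have := ltn_ord i; lia.
rewrite (@band_mul_lead _ _ _ _ 2 m _ _ i (Ordinal mn) 0) //=; first 1 last.
- exact: band_altW.
- by rewrite im; lia.
by rewrite (altW_lead sz) ?mul1r ?lm //= ?im /lead /= ?negbK //; lia.
Qed.

Definition krylov_mx : 'M[R]_n := \matrix_(i, j) krylov j i 0.

Lemma altX_krylov_mx : X *m krylov_mx = krylov_mx *m bidiag n (alt c).
Proof.
apply/matrixP => i j.
have kn : krylov n i 0 = 0 by have [bn _] := krylov_lead n; apply: bn; rewrite add0n.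
transitivity ((X *m krylov j) i 0).
  by rewrite !mxE; apply: eq_bigr => k _; rewrite [krylov_mx _ _]mxE.
rewrite X_krylov [RHS]mxE.
under [RHS]eq_bigr do rewrite [krylov_mx _ _]mxE.
rewrite (@sum_bidiag _ _ _ (fun k => krylov k i 0)) //.
by move: (krylov j) (krylov j.+1) => P Q; rewrite !mxE mulrC.
Qed.

Lemma det_krylov_mx : \det krylov_mx = \prod_(i < n) lead i.
Proof.
rewrite det_trig; last first.
  apply/is_trig_mxP => i j ij; rewrite mxE.
  by have [bj _] := krylov_lead j; apply: bj; rewrite add0n.
by apply: eq_bigr => i _; rewrite mxE; have [_ ->] := krylov_lead i.
Qed.

End Krylov.

(** * The theorem *)

Lemma hessenberg_comm (R : idomainType) (R_pid : is_PID R) (m : nat)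
    (A : 'M[R]_m.+1) : hessenberg A -> \tr A = 0 -> exists X Y, A = mx_comm X Y.
Proof.
move=> hA tA.
have [c [s [z [rel sz]]]] := superdiag_relation R_pid
  (\sum_(i < m.+1 | odd i) A i i) (fun i : 'I_m => A (inord i) (inord i.+1)).
rewrite -(trace_altX_mul c s z hA) in rel; set X := altX _ _ _ _ in rel.
have trX := trace_altX_pow hA tA rel.
have sol a b : exists Y, (\prod_(i < m.+1) lead c s a b i) ^+ 2 *: A = mx_comm X Y.
  rewrite -(@det_krylov_mx _ _ _ _ _ sz).
  apply: intertwined_comm trX; first exact: altX_krylov_mx.
  exact: bidiag_comm.
(* The start vectors (1, 0) and (c, 1 - s 0) give the two diagonals 1, s 0, ...
   and c, c, ... *)
have [Y1 E1] := sol 1 0; have [Y2 E2] := sol c (1 - s 0%N).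
have sc : comax (s 0%N) c by exists (s 1%N), (- z 0%N); rewrite mulrC sz; ring.
exists X; apply: comm_comb E1 E2.
apply: comaxXr; apply: comaxC; apply: comaxXr.
have prodP a b (t : R) : comax t a -> comax t (a * s 0%N + b * c) ->
  comax t (\prod_(i < m.+1) lead c s a b i).
  move=> ta tb; apply: big_ind => [||i _]; [exact: comax1|exact: comaxMr|].
  by rewrite /lead; case: odd.
apply: (prodP); first exact: comax1.
rewrite mul1r mul0r addr0; apply: comaxC; apply: (prodP) => //.
by rewrite (_ : _ + _ = c) //; ring.
Qed.

Theorem theorem6p3 (R : idomainType) (R_pid : is_PID R) (n : nat)
    (n_gt0 : (0 < n)%N) (A : 'M[R]_n) (trA0 : \tr A = 0) :
  exists X Y : 'M[R]_n, A = mx_comm X Y.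
Proof.
case: n n_gt0 A trA0 => // m _ A trA0.
have [U Uu hB] := @hessenberg_reduction R R_pid m A.
pose P : 'M[R]_(1 + m) := block_mx 1%:M 0 0 U.
pose Q : 'M[R]_(1 + m) := block_mx 1%:M 0 0 (invmx U).
have PQ : P *m Q = 1%:M.
  rewrite mulmx_block !(mul1mx, mulmx1, mul0mx, mulmx0, addr0, add0r).
  by rewrite mulmxV // -scalar_mx_block.
have QP : Q *m P = 1%:M by apply: mulmx1C.
have [|X [Y BXY]] := hessenberg_comm R_pid hB.
  by rewrite mxtrace_mulC mulmxA PQ mul1mx.
exists (P *m X *m Q), (P *m Y *m Q).
have AE : A = P *m (Q *m A *m P) *m Q by rewrite !mulmxA PQ mul1mx -mulmxA PQ mulmx1.
rewrite {1}AE BXY /mx_comm mulmxBr mulmxBl -!mulmxA.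
by rewrite !(mulmxA Q P) QP !mul1mx.
Qed.
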